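(* Let $l=\lambda_1Z_1+\dots+\lambda_nZ_n\in\mathbb{R}[Z_1,\dots,Z_n]$ be a linear form with $\lambda_1,\dots,\lambda_n\in\mathbb{R}$ not all zero, and let $f\in\mathbb{R}[X_1,\dots,X_n]$ be an $l$-sufficient symmetric polynomial. Let $m:=\max\{i\in\{1,\dots,n\} : \lambda_i\ne 0\}$. If $m$ is odd, then $f$ is $1$-complete.
   Context: Let $e_1,\dots,e_n$ be the elementary symmetric polynomials in $X_1,\dots,X_n$. A symmetric polynomial $f$, written uniquely as $f=g(e_1,\dots,e_n)$ with $g\in\mathbb{R}[Z_1,\dots,Z_n]$, is $l$-sufficient if $g\in\mathbb{R}[l]$, i.e. $g$ is a univariate polynomial in $l$. A symmetric polynomial $f$ is $1$-complete if $f(\mathbb{R}^n)=f(\mathcal{A}_1)$, where $\mathcal{A}_1=\{(t,\dots,t):t\in\mathbb{R}\}$ is the set of points of $\mathbb{R}^n$ with all coordinates equal. *)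

(* Defs.v *)
From mathcomp Require Import all_boot all_order all_algebra.
From mathcomp Require Import classical_sets reals.
From mathcomp Require Import mpoly.

Set Implicit Arguments.
Unset Strict Implicit.
Unset Printing Implicit Defensive.

Import Order.TTheory GRing.Theory Num.Theory.
Local Open Scope ring_scope.

Section Definitions.
Variables (R : realType) (n : nat).

(* Entry [i : 'I_n] is the elementary symmetric polynomial of degree [i.+1]. *)
Definition elementary : n.-tuple {mpoly R[n]} :=
  [tuple mesym n R i.+1 | i < n].

(* The 0-based [lam i] is the coefficient of the 1-based variable Z_(i+1). *)
Definition linear_form (lam : 'I_n -> R) : {mpoly R[n]} :=
  \sum_(i < n) lam i *: 'X_i.

(* The polynomial [g] with [f = g(e_1, ..., e_n)] is unique
   ([msym_fundamental_un]), so the existential does not depend on a choice. *)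
Definition sufficient (l f : {mpoly R[n]}) : Prop :=
  exists g : {mpoly R[n]},
    f = g \mPo elementary /\ exists p : {poly R}, g = horner_alg l p.

Definition diagonal : set ('I_n -> R) := [set fun=> t | t in [set: R]]%classic.

Definition one_complete (f : {mpoly R[n]}) : Prop :=
  [set f.@[x] | x in [set: 'I_n -> R]]%classic = [set f.@[x] | x in diagonal]%classic.

End Definitions.

(* Main.v *)
Require Import Defs.
From mathcomp Require Import all_boot all_order all_algebra.
From mathcomp Require Import classical_sets reals.
From mathcomp Require Import polyrcf mpoly.
Import Order.TTheory GRing.Theory Num.Theory.
Local Open Scope ring_scope.

(** On the diagonal, the form [l] evaluated at the elementary symmetric
    polynomials is a univariate polynomial in [t] of degree [m]: its top
    coefficient is [lam_m * 'C(n, m)]. For odd [m] it is onto, so [l], and hence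
    [f], takes every value it takes on all of R^n already on the diagonal. *)

(** An even size means odd degree, the bound [1 < size p] ruling out [p = 0]. Subtracting a constant
    keeps the size, so [p - y%:P] has a root in the real closed field. *)
Lemma odd_degree_surjective (R : rcfType) (p : {poly R}) (y : R) :
  (1 < size p)%N -> ~~ odd (size p) -> exists t, p.[t] = y.
Proof.
move=> p_gt1 p_odd.
have [|t /rootP] := @odd_poly_root R (p - y%:P).
  rewrite size_polyDl // size_polyN.
  exact: leq_ltn_trans (size_polyC_leq1 y) p_gt1.
by rewrite hornerD hornerN hornerC => /subr0_eq; exists t.
Qed.

Lemma meval_mesym_const (R : comNzRingType) (n k : nat) (t : R) :
  (mesym n R k).@[fun=> t] = 'C(n, k)%:R * t ^+ k.
Proof.
rewrite /mesym raddf_sum /=.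
rewrite (eq_bigr (fun=> t ^+ k)) => [|h /eqP h_k].
  by rewrite sumr_const -cardsE card_draws card_ord mulr_natl.
rewrite rmorph_prod /= (eq_bigr (fun=> t)) => [|i _]; last exact: mevalXU.
by rewrite prodr_const h_k.
Qed.

Lemma meval_horner_alg (R : comNzRingType) (n : nat) (x : 'I_n -> R)
    (l : {mpoly R[n]}) (p : {poly R}) :
  (horner_alg l p).@[x] = p.[l.@[x]].
Proof.
elim/poly_ind: p => [|p c IHp]; first by rewrite !rmorph0 horner0.
rewrite rmorphD rmorphM /= horner_algX horner_algC mevalD mevalM IHp.
by rewrite mevalZ meval1 mulr1 hornerMXaddC.
Qed.

Lemma meval_linear_form (R : realType) (n : nat) (lam z : 'I_n -> R) :
  (linear_form lam).@[z] = \sum_(i < n) lam i * z i.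
Proof.
rewrite /linear_form raddf_sum /=.
by apply: eq_bigr => i _; rewrite mevalZ mevalXU.
Qed.

Definition diagonal_poly {R : realType} {n : nat} (lam : 'I_n -> R) : {poly R} :=
  \sum_(i < n) (lam i * 'C(n, i.+1)%:R) *: 'X^(i.+1).

Lemma horner_diagonal_poly (R : realType) (n : nat) (lam : 'I_n -> R) (t : R) :
  (diagonal_poly lam).[t] =
  \sum_(i < n) lam i * (tnth (elementary R n) i).@[fun=> t].
Proof.
rewrite /diagonal_poly horner_sum; apply: eq_bigr => i _.
by rewrite hornerZ hornerXn tnth_mktuple meval_mesym_const mulrA.
Qed.

(** The summands have pairwise distinct degrees, so the top one cannot cancel. *)
Lemma size_diagonal_poly (R : realType) (n : nat) (lam : 'I_n -> R) :
  (exists i, lam i != 0) ->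
  size (diagonal_poly lam) = (\max_(i < n | lam i != 0) i.+1).+1.
Proof.
case=> i1 lam_i1; set m := (\max_(i < n | _) _)%N.
have [|i0 lam_i0 m_i0] := @eq_bigmax_cond _ [pred i | lam i != 0] (fun i => i.+1).
  by apply/card_gt0P; exists i1.
have {}m_i0 : m = i0.+1 by [].
(* The binomial is positive because [i0 < n], and stays nonzero in [R] by characteristic zero. *)
have top_neq0 : lam i0 * 'C(n, i0.+1)%:R != 0.
  by rewrite mulf_neq0 // pnatr_eq0 -lt0n bin_gt0.
rewrite /diagonal_poly (bigD1 i0) //= size_polyDl ?size_scale ?size_polyXn ?m_i0 //.
rewrite ltnS; apply: leq_trans (size_sum _ _ _) _; apply/bigmax_leqP => i ne_i.
(* Indices beyond [i0] fall in the zero case; a nonzero [lam i] with [i != i0] forces [i < i0] by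
   maximality. *)
have [->|lam_i] := eqVneq (lam i) 0; first by rewrite mul0r scale0r size_poly0.
apply: leq_trans (size_scale_leq _ _) _; rewrite size_polyXn.
have : (i.+1 <= m)%N by rewrite /m; apply: leq_bigmax_cond.
by rewrite m_i0 !ltnS => le_i; rewrite ltn_neqAle ne_i.
Qed.

Theorem theorem4p6 (R : realType) (n : nat) (lam : 'I_n -> R)
    (lam_neq0 : exists i, lam i != 0)
    (f : {mpoly R[n]}) (f_sym : f \is symmetric)
    (f_suff : sufficient (linear_form lam) f)
    (m : nat) (m_def : m = (\max_(i < n | lam i != 0%R) i.+1)%N)
    (m_odd : odd m) :
  one_complete f.
Proof.
case: f_suff => g [f_g [p g_p]].
have fE x : f.@[x] = p.[\sum_(i < n) lam i * (tnth (elementary R n) i).@[x]].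
  by rewrite f_g comp_mpoly_meval g_p meval_horner_alg meval_linear_form.
rewrite /one_complete; apply/seteqP; split=> y [x _ <-]; last by exists x.
have size_q := size_diagonal_poly _ _ _ lam_neq0; rewrite -m_def in size_q.
(* By [fE], [f] sees a point only through the value of the form at its elementary symmetric
   functions, so it suffices to match the value at [x] on the diagonal. The degree is [m], which is
   positive because it is odd. *)
have [||t qt] := @odd_degree_surjective _ (diagonal_poly lam)
    (\sum_(i < n) lam i * (tnth (elementary R n) i).@[x]).
- by rewrite size_q ltnS odd_gt0.
- by rewrite size_q /= m_odd.
exists (fun=> t); first by exists t.
by rewrite !fE -horner_diagonal_poly qt.
Qed.
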